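(* Suppose that a scoring procedure $\mathcal{S}$ is such that there exists a function $f$ defined on finite nonempty multisets of real triples and possessing the following properties, where $s=(s_1,\dots,s_n)^{\top}=\mathcal{S}(\mathcal{A})$ denotes the score vector that $\mathcal{S}$ assigns to the profile $\mathcal{A}$. (i) For every $\mathcal{A}$, $$f(\langle (a_{ij}^p,s_i,s_j)\mid j,p\rangle)=0,\qquad i=1,\dots,n.$$ (ii) $f$ is - increasing in every $a_{ij}^p$, - increasing in every $s_j$ ($j\ne i$), - decreasing in $s_i$. (iii) Let $V_i=\langle (a_{ij}^p,s_i,s_j)\mid j,p\rangle$. For every $\mathcal{A}$ and for every $i,k\in J$: - if $(1,s_i,s_k)\in V_i$, then $f(V_i\setminus\langle(1,s_i,s_k)\rangle)<f(V_i)$; - if $(0,s_i,s_k)\in V_i$, then $f(V_i\setminus\langle(0,s_i,s_k)\rangle)>f(V_i)$. Then the scoring procedure $\mathcal{S}$ satisfies Self-Consistent Monotonicity (SCM).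
   Context: **Profiles.** $J=\{1,\dots,n\}$ is a set of alternatives and there are $m$ individuals. The $p$th individual's responses give an incomplete paired comparison matrix $A^{(p)}=[a_{ij}^p]$: if individual $p$ says that $i$ is better than $j$, then $a_{ij}^p=1$ and $a_{ji}^p=0$; if $p$ says that $i$ and $j$ are equivalent, then $a_{ij}^p=a_{ji}^p=1/2$; if $p$ does not report an opinion on the pair, $a_{ij}^p$ and $a_{ji}^p$ remain undefined. By definition all diagonal entries are zero: $a_{ii}^p=0$. A profile is $\mathcal{A}=(A^{(1)},\dots,A^{(m)})$. **Scoring procedures.** A scoring procedure $\mathcal{S}$ is a function from the set of all profiles (or a subset of it) into $\mathbb{R}^n$; the $i$th component $s_i$ of the resulting column vector $s=(s_1,\dots,s_n)^{\top}$ is the score of alternative $i$. All scoring procedures are assumed neutral (any reindexing of the alternatives preserves their scores) and anonymous (any reindexing of the individuals preserves the scores of the alternatives). **Multisets.** A multiset may contain the same element in several copies; multisets are written in angle brackets. Multisets indexed by an alternative and an individual (such as $\langle\cdot\mid j,p\rangle$) are formed from the entries that are defined. $V\setminus\langle x\rangle$ is multiset difference. **Self-Consistent Monotonicity (SCM).** A scoring procedure $\mathcal{S}$ is self-consistently monotonic if for any set of alternatives $J$, any profile $\mathcal{A}$, and any alternatives $i,j\in J$ it satisfies the following condition. Suppose $U_i=\langle a_{ik}^p\mid k,p\rangle$ and $U_j=\langle a_{j\ell}^q\mid \ell,q\rangle$ are the multisets of the comparison outcomes of $i$ and $j$, respectively. Suppose that $U_i$ can be split into $U_i^{I}$ and $U_i^{II}$,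 and $U_j$ can be split into $U_j^{I}$ and $U_j^{II}$, in such a way that (a) $a_{ik}^p\in U_i^{I}$ implies $a_{ik}^p=1$, and $a_{j\ell}^q\in U_j^{I}$ implies $a_{j\ell}^q=0$; (b) there exists a one-to-one correspondence $\pi$ of $U_i^{II}$ onto $U_j^{II}$ such that $\pi(a_{ik}^p)=a_{j\ell}^q$ implies $a_{ik}^p\ge a_{j\ell}^q$ and $s_k\ge s_\ell$. Then $s_i\ge s_j$. Moreover, if in addition $U_i^{I}$ is nonempty or $U_j^{I}$ is nonempty or at least one inequality in (b) is strict at least once, then $s_i>s_j$.
   Formalization: Condition (iii) is required for every sub-multiset W of V_i (with a nonempty remainder), not only for V_i itself; with (iii) for V_i alone the claim is false, as SCM may require removing several outcomes in succession. *)

(* Defs.v *)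
From HB Require Import structures.
From mathcomp Require Import all_boot all_order all_algebra all_fingroup.
From mathcomp Require Import finmap multiset.
From mathcomp Require Import reals.

Set Implicit Arguments.
Unset Strict Implicit.
Unset Printing Implicit Defensive.

Import Order.TTheory GRing.Theory Num.Theory.
Local Open Scope ring_scope.
Local Open Scope mset_scope.

(* Alternatives are 'I_n and individuals are 'I_m. *)

(* None stands for an undefined entry; diagonal entries are defined and 0. *)
Definition incomplete_pcm (R : realType) (n : nat) (M : 'M[option R]_n) : bool :=
  [forall i, M i i == Some 0] &&
  [forall i, forall j, (i != j) ==>
     ((M i j, M j i) \in [:: (Some 1, Some 0); (Some 0, Some 1);
                            (Some 2^-1, Some 2^-1); (None, None)])].

(* There is at least one individual: without individuals every multiset of
   outcomes would be empty. *)
Definition is_profile (R : realType) (n m : nat)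
    (A : m.-tuple 'M[option R]_n) : bool :=
  (0 < m)%N && [forall p, incomplete_pcm (tnth A p)].

Definition reindex_alternatives (R : realType) (n m : nat) (sigma : 'S_n)
    (A : m.-tuple 'M[option R]_n) : m.-tuple 'M[option R]_n :=
  [tuple mxsub sigma sigma (tnth A p) | p < m].

Definition reindex_individuals (R : realType) (n m : nat) (tau : 'S_m)
    (A : m.-tuple 'M[option R]_n) : m.-tuple 'M[option R]_n :=
  [tuple tnth A (tau p) | p < m].

(* A scoring procedure may be defined on a subset sp_dom of the profiles only;
   the values of sp_score outside sp_dom are irrelevant.  *)
Record scoring_procedure (R : realType) := ScoringProcedure {
  sp_dom : forall n m : nat, m.-tuple 'M[option R]_n -> Prop;
  sp_score : forall n m : nat, m.-tuple 'M[option R]_n -> 'cV[R]_n;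
  sp_dom_profile : forall n m (A : m.-tuple 'M[option R]_n),
    sp_dom A -> is_profile A;
  sp_neutral : forall n m (A : m.-tuple 'M[option R]_n) (sigma : 'S_n),
    sp_dom A -> sp_dom (reindex_alternatives sigma A) ->
    forall i, sp_score (reindex_alternatives sigma A) i 0 =
              sp_score A (sigma i) 0;
  sp_anonymous : forall n m (A : m.-tuple 'M[option R]_n) (tau : 'S_m),
    sp_dom A -> sp_dom (reindex_individuals tau A) ->
    sp_score (reindex_individuals tau A) = sp_score A
}.

(* The pairs (j, p) such that the entry a_ij^p is defined, including the
   diagonal ones (i, p). *)
Definition comparisons (R : realType) (n m : nat)
    (A : m.-tuple 'M[option R]_n) (i : 'I_n) : {set 'I_n * 'I_m} :=
  [set t | tnth A t.2 i t.1 != None].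

(* The entry a_ij^p, to be used for t = (j, p) in comparisons A i only. *)
Definition outcome (R : realType) (n m : nat)
    (A : m.-tuple 'M[option R]_n) (i : 'I_n) (t : 'I_n * 'I_m) : R :=
  odflt 0 (tnth A t.2 i t.1).

(* V_i = < (a_ij^p, s_i, s_j) | j, p > *)
Definition comparison_mset (R : realType) (n m : nat)
    (A : m.-tuple 'M[option R]_n) (s : 'cV[R]_n) (i : 'I_n) :
    {mset R * R * R} :=
  seq_mset [seq (outcome A i t, s i 0, s t.1 0) | t in comparisons A i].

(* < (a, x, y) | (a, y) in r >: the multisets of triples sharing the same
   second component, as in comparison_mset. *)
Definition triples (R : realType) (x : R) (r : seq (R * R)) : {mset R * R * R} :=
  seq_mset [seq (u.1, x, u.2) | u <- r].

(* The first, second and third components of the triples are the arguments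
   a_ij^p, s_i and s_j; s_i is common to all the triples of a multiset. *)
Definition monotone_in_components (R : realType) (f : {mset R * R * R} -> R) :=
  [/\ forall (x y a a' : R) (r : seq (R * R)), a < a' ->
        f (triples x ((a, y) :: r)) < f (triples x ((a', y) :: r)),
      forall (x a y y' : R) (r : seq (R * R)), y < y' ->
        f (triples x ((a, y) :: r)) < f (triples x ((a, y') :: r)) &
      forall (x x' : R) (r : seq (R * R)), r != [::] -> x < x' ->
        f (triples x' r) < f (triples x r)].

(* The multisets U_i and U_j of labelled entries a_ik^p and a_jl^q are
   identified with their sets of labels (k, p) and (l, q), since the
   correspondence pi also refers to the alternatives k and l. *)
Definition self_consistently_monotonic (R : realType)
    (S : scoring_procedure R) : Prop :=
  forall (n m : nat) (A : m.-tuple 'M[option R]_n), sp_dom S A ->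
  let s := sp_score S A in
  forall (i j : 'I_n) (Ui1 Ui2 Uj1 Uj2 : {set 'I_n * 'I_m})
         (pi : 'I_n * 'I_m -> 'I_n * 'I_m),
    Ui1 :|: Ui2 = comparisons A i -> [disjoint Ui1 & Ui2] ->
    Uj1 :|: Uj2 = comparisons A j -> [disjoint Uj1 & Uj2] ->
    (forall t, t \in Ui1 -> outcome A i t = 1) ->
    (forall u, u \in Uj1 -> outcome A j u = 0) ->
    {in Ui2 &, injective pi} -> pi @: Ui2 = Uj2 ->
    (forall t, t \in Ui2 ->
       outcome A i t >= outcome A j (pi t) /\ s t.1 0 >= s (pi t).1 0) ->
    s i 0 >= s j 0 /\
    ([\/ Ui1 != set0, Uj1 != set0 |
         exists2 t, t \in Ui2 &
           outcome A i t > outcome A j (pi t) \/ s t.1 0 > s (pi t).1 0] ->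
     s i 0 > s j 0).

(* Main.v *)
Require Import Defs.
From mathcomp Require Import all_boot all_order all_algebra.
From mathcomp Require Import finmap multiset.
From mathcomp Require Import reals.

Set Implicit Arguments.
Unset Strict Implicit.
Unset Printing Implicit Defensive.

Import Order.TTheory GRing.Theory Num.Theory.
Local Open Scope ring_scope.
Local Open Scope mset_scope.

(* Every V_i keeps the diagonal entries (0, s_i, s_i), so the parts U_i^II and
   U_j^II are nonempty. If s_i <= s_j, then (iii), (ii) and (i) give
     0 = f(V_j) <= f(V_j^II) <= f(V_i^II) <= f(V_i) = 0,
   so that equality holds everywhere, which rules out every source of
   strictness: U_i^I and U_j^I are empty, s_i = s_j, and all the inequalities
   of (b) are equalities. *)

(** Induction on the number of elements of [C] missing from [D]: they are added one at a time, each
    strictly raising [g], so equality means that nothing was added. *)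
Lemma leif_set_chain (R : numDomainType) (T : finType) (g : {set T} -> R)
    (D C : {set T}) :
  D \subset C ->
  (forall t (B : {set T}), D \subset B -> t \notin B -> t |: B \subset C ->
     g B < g (t |: B)) ->
  g D <= g C ?= iff (D == C).
Proof.
move: {2}#|_| (erefl #|C :\: D|) => k.
elim: k D => [|k IHk] D Dk sDC gmono.
  have -> : D = C.
    by apply/eqP; rewrite eqEsubset sDC -finset.setD_eq0 -cards_eq0 Dk.
  by apply/leif_refl; rewrite eqxx.
have /card_gt0P[t] : (0 < #|C :\: D|)%N by rewrite Dk.
rewrite inE => /andP[tND tC].
have stDC : t |: D \subset C by rewrite subUset sub1set tC.
have := gmono t D (subxx _) tND stDC => lt_g.
have neqDC : (D == C) = false.
  by apply/eqP => eDC; rewrite eDC tC in tND.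
have [|||le_g _] := IHk (t |: D).
- by move: Dk; rewrite (cardsD1 t) inE tND tC setDDl setUC => -[].
- exact: stDC.
- by move=> u B sB; apply: gmono; apply: subset_trans sB; apply: subsetUr.
by rewrite neqDC; apply/leifP; apply: lt_le_trans le_g.
Qed.

Lemma perm_triples (R : realType) (x : R) (r r' : seq (R * R)) :
  perm_eq r r' -> triples x r = triples x r'.
Proof. by move=> err'; apply/eq_seq_msetP; apply: perm_map. Qed.

Lemma triples_eq0 (R : realType) (x : R) (r : seq (R * R)) :
  (triples x r == mset0) = (r == [::]).
Proof.
by rewrite -size_mset_eq0 (perm_size (perm_eq_seq_mset _)) size_map size_eq0.
Qed.

(** The pairs are replaced one by one, first component before second; by (ii) each genuine change is
    strict, so equality forces every pair to be unchanged. *)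
Lemma triples_leif (R : realType) (f : {mset R * R * R} -> R) (T : eqType)
    (x : R) (h h' : T -> R * R) (ts : seq T) :
  monotone_in_components f ->
  (forall t, t \in ts -> (h t).1 <= (h' t).1 /\ (h t).2 <= (h' t).2) ->
  f (triples x (map h ts)) <= f (triples x (map h' ts))
    ?= iff all (fun t => h t == h' t) ts.
Proof.
move=> [f1 f2 _] le_h; rewrite -[map h ts]cats0 -[map h' ts]cats0.
(* The generalized tail [r], initially empty, collects the pairs already replaced. *)
elim: ts [::] le_h => [|t ts IHts] r le_h /=; first exact/leif_refl.
have [|le1 le2] := le_h t; first exact: mem_head.
apply: (@leif_trans _ _ _ (f (triples x (h' t :: map h ts ++ r)))).
  case: (h t) (h' t) le1 le2 => a y [a' y'] /= le1 le2; rewrite xpair_eqE.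
  apply: (@leif_trans _ _ _ (f (triples x ((a', y) :: map h ts ++ r)))).
    by apply/leifP; case: (ltgtP a a') le1 => // [lt_a _ | -> _];
      rewrite ?eqxx ?f1.
  by apply/leifP; case: (ltgtP y y') le2 => // [lt_y _ | -> _];
    rewrite ?eqxx ?f2.
rewrite -![h' t :: _ ++ r]cat1s.
rewrite !(perm_triples x (permEl (perm_catCA [:: _] _ _))).
by apply: IHts => u uts; apply: le_h; rewrite inE uts orbT.
Qed.

Lemma monotone_leif_snd (R : realType) (f : {mset R * R * R} -> R)
    (x x' : R) (r : seq (R * R)) :
  monotone_in_components f -> r != [::] -> x <= x' ->
  f (triples x' r) <= f (triples x r) ?= iff (x == x').
Proof.
move=> [_ _ f3] r0 le_x; apply/leifP.
by case: (ltgtP x x') le_x => // [lt_x _ | -> _]; rewrite ?eqxx ?f3.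
Qed.

Section Restriction.
Variables (R : realType) (n m : nat) (A : m.-tuple 'M[option R]_n).
Variables (s : 'cV[R]_n) (i : 'I_n).

Definition response (t : 'I_n * 'I_m) : R * R := (outcome A i t, s t.1 0).

(* The part of V_i with labels in D; V_i^II is the case D = Ui2. *)
Definition restricted_mset (D : {set 'I_n * 'I_m}) : {mset R * R * R} :=
  triples (s i 0) [seq response t | t in D].

Lemma restricted_mset_comparisons :
  restricted_mset (comparisons A i) = comparison_mset A s i.
Proof. by rewrite /restricted_mset /triples -map_comp. Qed.

Lemma restricted_mset_eq0 (D : {set 'I_n * 'I_m}) :
  (restricted_mset D == mset0) = (D == set0).
Proof. by rewrite triples_eq0 -size_eq0 size_image cards_eq0. Qed.

(** This turns the removal of a triple in (iii) into the removal of the label [t]. *)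
Lemma restricted_msetU1 t (D : {set 'I_n * 'I_m}) : t \notin D ->
  restricted_mset (t |: D)
    = (outcome A i t, s i 0, s t.1 0) +` restricted_mset D.
Proof.
move=> tD; rewrite -mset_cons; apply/eq_seq_msetP.
rewrite -[_ :: _]/[seq (u.1, s i 0, u.2) | u <- map response (t :: enum D)].
do 2!apply: perm_map; apply: uniq_perm; first exact: enum_uniq.
  by rewrite /= mem_enum tD enum_uniq.
by move=> u; rewrite inE !mem_enum !inE.
Qed.

Lemma restricted_msetS (D C : {set 'I_n * 'I_m}) :
  D \subset C -> (restricted_mset D `<=` restricted_mset C)%mset.
Proof.
move=> /subsetP sDC; apply/msubsetP => w.
rewrite !mset_seqE !count_map /enum_mem !count_filter.
by apply: sub_count => t /= /andP[-> /sDC].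
Qed.

(** Re-indexing by [D] lets the responses matched by [pi] be compared along one list, as
    [triples_leif] requires. *)
Lemma triples_imset x (pi : 'I_n * 'I_m -> 'I_n * 'I_m)
    (D : {set 'I_n * 'I_m}) :
  {in D &, injective pi} ->
  triples x [seq response t | t in pi @: D]
    = triples x [seq response (pi t) | t <- enum D].
Proof.
move=> inj_pi; apply: perm_triples; rewrite (map_comp response pi).
apply: perm_map; apply: uniq_perm; first exact: enum_uniq.
  rewrite map_inj_in_uniq ?enum_uniq // => t u.
  by rewrite !mem_enum; apply: inj_pi.
move=> u; rewrite mem_enum; apply/imsetP/mapP => -[t tD ->]; exists t => //.
  by rewrite mem_enum.
by rewrite mem_enum in tD.
Qed.

End Restriction.

(* MathComp world.  f is only constrained on nonempty multisets. *)
Theorem theorem12 (R : realType) (S : scoring_procedure R) :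
  (exists f : {mset R * R * R} -> R,
    [/\ (* (i) *)
        forall (n m : nat) (A : m.-tuple 'M[option R]_n), sp_dom S A ->
          forall i : 'I_n, f (comparison_mset A (sp_score S A) i) = 0,
        (* (ii) *)
        monotone_in_components f &
        (* (iii), for the nonempty sub-multisets W of V_i *)
        forall (n m : nat) (A : m.-tuple 'M[option R]_n), sp_dom S A ->
          let s := sp_score S A in
          forall (i k : 'I_n) (W : {mset R * R * R}),
            (W `<=` comparison_mset A s i)%mset ->
            ((1, s i 0, s k 0) \in W ->
             (W `\` [mset (1, s i 0, s k 0)])%mset != mset0 ->
             f (W `\` [mset (1, s i 0, s k 0)])%mset < f W) /\
            ((0, s i 0, s k 0) \in W ->
             (W `\` [mset (0, s i 0, s k 0)])%mset != mset0 ->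
             f W < f (W `\` [mset (0, s i 0, s k 0)])%mset)]) ->
  self_consistently_monotonic S.
Proof.
move=> [f [f0 fmono frem]] n m A domA s i j Ui1 Ui2 Uj1 Uj2 pi.
move=> defCi disi defCj disj Ui1_1 Uj1_0 inj_pi pi_img le_pi.
(* A profile has at least one individual [p]; the diagonal label [(i, p)] has outcome 0, so it
   cannot lie in [Ui1], whose outcomes are 1. *)
have Ui2_neq0 : Ui2 != set0.
  have [m_gt0 /forallP profA] := andP (sp_dom_profile domA).
  pose p := Ordinal m_gt0.
  have Aii : tnth A p i i = Some 0.
    by have /andP[/forallP/(_ i)/eqP] := profA p.
  have : (i, p) \in Ui1 :|: Ui2 by rewrite defCi inE Aii.
  rewrite inE => /orP[/Ui1_1|ipU]; last by apply/set0Pn; exists (i, p).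
  by rewrite /outcome Aii /= => /esym/eqP; rewrite oner_eq0.
have Uj2_neq0 : Uj2 != set0 by rewrite -pi_img imset_eq0.
have sub_V k (D : {set 'I_n * 'I_m}) : D \subset comparisons A k ->
    (restricted_mset A s k D `<=` comparison_mset A s k)%mset.
  by move=> sDC; rewrite -restricted_mset_comparisons restricted_msetS.
(* Every label added to [Ui2] on the way to [comparisons A i] comes from [Ui1], so its outcome is 1
   and (iii) makes [f] grow up to the value 0 given by (i). *)
have grow_i : f (restricted_mset A s i Ui2) <= 0
    ?= iff (Ui2 == comparisons A i).
  rewrite -(f0 n m A domA i) -restricted_mset_comparisons.
  apply: (leif_set_chain (g := fun D => f (restricted_mset A s i D))).
    by rewrite -defCi subsetUr.
  move=> t B sB tB stC.
  have [frem1 _] := frem n m A domA i t.1 _ (sub_V i _ stC).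
  have o1 : outcome A i t = 1.
    apply: Ui1_1; have := subsetP stC t (setU11 _ _).
    by rewrite -defCi inE => /orP[//|/(subsetP sB)]; rewrite (negPf tB).
  rewrite (restricted_msetU1 A s _ tB) o1 msetD1K in frem1 *.
  apply: frem1; first by rewrite in_mset1D eqxx.
  (* (iii) requires the remaining multiset to be nonempty, which holds because [B] contains
     [Ui2]. *)
  rewrite restricted_mset_eq0; apply: contraNneq Ui2_neq0 => B0.
  by rewrite -subset0 -B0.
have grow_j : 0 <= f (restricted_mset A s j Uj2)
    ?= iff (Uj2 == comparisons A j).
  rewrite -(f0 n m A domA j) -restricted_mset_comparisons.
  (* The labels added here have outcome 0 and lower [f], so the chain lemma is applied to [- f]. *)
  suff: - f (restricted_mset A s j Uj2)
      <= - f (restricted_mset A s j (comparisons A j))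
      ?= iff (Uj2 == comparisons A j).
    by rewrite /Order.leif lerN2 eqr_opp eq_sym.
  apply: (leif_set_chain (g := fun D => - f (restricted_mset A s j D))).
    by rewrite -defCj subsetUr.
  move=> t B sB tB stC; rewrite ltrN2.
  have [_ frem0] := frem n m A domA j t.1 _ (sub_V j _ stC).
  have o0 : outcome A j t = 0.
    apply: Uj1_0; have := subsetP stC t (setU11 _ _).
    by rewrite -defCj inE => /orP[//|/(subsetP sB)]; rewrite (negPf tB).
  rewrite (restricted_msetU1 A s _ tB) o0 msetD1K in frem0 *.
  apply: frem0; first by rewrite in_mset1D eqxx.
  rewrite restricted_mset_eq0; apply: contraNneq Uj2_neq0 => B0.
  by rewrite -subset0 -B0.
have compare : s i 0 <= s j 0 ->
    [/\ s i 0 = s j 0, Ui1 = set0, Uj1 = set0 &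
        forall t, t \in Ui2 ->
          outcome A i t = outcome A j (pi t) /\ s t.1 0 = s (pi t).1 0].
  move=> le_ij.
  have Uj2_seq : [seq response A s j t | t in Uj2] != [::].
    by rewrite -size_eq0 size_image cards_eq0.
  (* The intermediate multiset keeps the responses of [j] but carries the score of [i], which
     separates the change of own score from the change of responses. *)
  have le_mid := monotone_leif_snd fmono Uj2_seq le_ij.
  have le_dom : f (triples (s i 0) [seq response A s j t | t in Uj2])
      <= f (restricted_mset A s i Ui2)
      ?= iff all (fun t => response A s j (pi t) == response A s i t)
                 (enum Ui2).
    rewrite -pi_img triples_imset //; apply: triples_leif => // t.
    by rewrite mem_enum => /le_pi.
  (* The chain runs from 0 to 0, so the equality conditions of all four links hold at once. *)
  have := leif_trans grow_j (leif_trans le_mid (leif_trans le_dom grow_i)).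
  move=> [_]; rewrite eqxx.
  move=> /esym/and4P[/eqP Uj2C /eqP eq_ij /allP eq_pi /eqP Ui2C].
  split => //.
  (* Since [Ui2] is all of [comparisons A i], it contains [Ui1], which is disjoint from it and hence
     empty. *)
  - by rewrite -(disjoint_setI0 disi); apply/esym/setIidPl;
      rewrite Ui2C -defCi subsetUl.
  - by rewrite -(disjoint_setI0 disj); apply/esym/setIidPl;
      rewrite Uj2C -defCj subsetUl.
  move=> t tU; have := eq_pi t; rewrite mem_enum => /(_ tU) /eqP.
  by case=> -> ->.
split; first by case: (leP (s i 0) (s j 0)) => [/compare[-> //]|/ltW].
move=> strict; rewrite ltNge; apply/negP => /compare[_ Ui1_0 Uj1_0' eq_pi].
case: strict => [/eqP//|/eqP//|[t /eq_pi[-> ->]]].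
by rewrite !ltxx => -[].
Qed.
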